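(* Let $k\ge 2$ and $n$ be integers with $n\ge k^2$. Then $$m(n+1,k,1)=m(n,k,1)+\binom{n}{k}.$$
   Context: For integers $n\ge k+1$, let $\mathcal V(n,k,1)\subset\mathbb R^n$ be the set of all vectors with coordinates in $\{0,1,-1\}$ having exactly $k$ coordinates equal to $+1$ and exactly one coordinate equal to $-1$ (all other coordinates $0$). For $n\ge 2k$ the minimum possible scalar product of two vectors in $\mathcal V(n,k,1)$ is $-2$. A family $\mathcal V\subset\mathcal V(n,k,1)$ is called intersecting if $\langle v,w\rangle>-2$ for all $v,w\in\mathcal V$. Let $m(n,k,1)$ be the maximum of $|\mathcal V|$ over all intersecting families $\mathcal V\subset\mathcal V(n,k,1)$. *)

(* Defs.v *)
From HB Require Import structures.
From mathcomp Require Import all_boot all_order all_algebra.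
From mathcomp Require Import reals.
Set Implicit Arguments. Unset Strict Implicit. Unset Printing Implicit Defensive.
Import Order.TTheory GRing.Theory Num.Theory.
Local Open Scope ring_scope.

Definition dotv (R : realType) (n : nat) (v w : 'rV[R]_n) : R :=
  \sum_(i < n) v 0 i * w 0 i.

Definition inV1 (R : realType) (n k : nat) (v : 'rV[R]_n) : bool :=
  [&& [forall i : 'I_n, v 0 i \in [:: 0; 1; -1]],
      #|[set i : 'I_n | v 0 i == 1]| == k
    & #|[set i : 'I_n | v 0 i == -1]| == 1%N].

Record V1 (R : realType) (n k : nat) : Type :=
  MkV1 { vec :> 'rV[R]_n; vecP : inV1 k vec }.

HB.instance Definition _ (R : realType) (n k : nat) :=
  [isSub for @vec R n k].
HB.instance Definition _ (R : realType) (n k : nat) :=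
  [Choice of V1 R n k by <:].

(* V1 R n k is finite although 'rV[R]_n is not: an element is determined by
   the positions of its coordinates 1 and -1. *)
Definition V1_code (R : realType) (n k : nat) (v : V1 R n k) :
    {set 'I_n} * {set 'I_n} :=
  ([set i | vec v 0 i == 1], [set i | vec v 0 i == -1]).

Definition V1_decode (R : realType) (n k : nat)
    (c : {set 'I_n} * {set 'I_n}) : option (V1 R n k) :=
  insub (\row_i (if i \in c.1 then 1 else if i \in c.2 then -1 else 0)).

Lemma V1_codeK (R : realType) (n k : nat) :
  pcancel (@V1_code R n k) (@V1_decode R n k).
Proof.
move=> v; rewrite /V1_decode; set r := \row_i _.
suff -> : r = val v by rewrite valK.
apply/rowP => i; rewrite !mxE !inE /=.
have /and3P[/forallP/(_ i) + _ _] := vecP v; rewrite !inE.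
have [->//|_] := eqVneq (vec v 0 i) 1.
by have [->//|_] := eqVneq (vec v 0 i) (-1); rewrite !orbF => /eqP ->.
Qed.

HB.instance Definition _ (R : realType) (n k : nat) :=
  PCanIsCountable (@V1_codeK R n k).
HB.instance Definition _ (R : realType) (n k : nat) :=
  isFinite.Build (V1 R n k) (pcan_enumP (@V1_codeK R n k)).

Definition intersecting (R : realType) (n k : nat) (F : {set V1 R n k}) : bool :=
  [forall v in F, forall w in F, dotv (vec v) (vec w) > -2].

Definition m1 (R : realType) (n k : nat) : nat :=
  \max_(F : {set V1 R n k} | intersecting F) #|F|.

(* Main.v *)
Require Import Defs.
From mathcomp Require Import all_boot all_order all_algebra.
From mathcomp Require Import all_fingroup all_solvable.
From mathcomp Require Import reals ring lra.
Set Implicit Arguments. Unset Strict Implicit. Unset Printing Implicit Defensive.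

(* A vector with its -1 at [a] and its 1s on [A] is coded by the pair [(a, A)];
   the scalar product of [(a, A)] and [(b, B)] is -2 exactly when [a \in B],
   [b \in A] and [A], [B] are disjoint. Let [N] be the last of the [n + 1]
   coordinates.

   Lower bound: add to an extremal family on the first [n] coordinates all the
   vectors whose -1 is at [N].

   Upper bound: replacing a vector by its image under the transposition of
   [x] and [N] whenever this decreases the coordinate at [N] and the image is
   not in the family preserves the size and the intersecting property. So there
   is an extremal family [F] stable under these shifts. The vectors of [F]
   vanishing at [N] form an intersecting family on [n] coordinates. Let [X] be
   the sets [A] with [(N, A)] in [F], and [G] the pairs [(b, B)] with
   [(b, B + N)] in [F]. Then [B + b] is in [X] by stability, and [b \in A]
   forces [A] to meet [B] for [A] in [X].
   As [n >= k ^ 2], we may fix a [k]-set [A0] and [k] sets [D_j] of size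
   [k - 1], disjoint from each other and from [A0]. For a permutation [s], if
   [s A0] is in [X], then none of the [k ^ 2] pairs [(s b, s D_j)] with
   [b \in A0] is in [G]; otherwise at most one is for each [b], so at most [k]
   are. Averaging over [s] shows that [G] is not larger than the set of
   [k]-sets outside [X], i.e. [#|X| + #|G| <= 'C(n, k)]. *)

(** * Orbit counting and the action of permutations on coded vectors *)

Lemma count_orbit (gT : finGroupType) (X : finType) (to : {action gT &-> X})
    (x : X) (Y : {set X}) :
  Y \subset orbit to setT x ->
  #|[set s | to x s \in Y]| * #|orbit to setT x| = #|Y| * #|{: gT}|.
Proof.
move=> sYO; have fib y : y \in Y -> #|[set s | to x s == y]| = #|'C[x | to]%g|.
  (* The elements sending [x] to a given point of its orbit form a coset of the stabilizer, so all
     fibres have the same size. *)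
  move=> /(subsetP sYO)/orbitP[a _ <-].
  have -> : [set s | to x s == to x a] = amove to setT x (to x a).
    by apply/setP=> s; rewrite !inE.
  by rewrite amove_act ?subsetT ?inE // card_rcoset setTI.
have -> : #|[set s | to x s \in Y]| = #|Y| * #|'C[x | to]%g|.
  rewrite -sum1_card (partition_big (to x) (mem Y)) /= => [|s]; last by rewrite inE.
  rewrite -sum_nat_const; apply: eq_bigr => y Yy; rewrite -(fib y Yy) -sum1_card.
  by apply: eq_bigl => s; rewrite !inE; case: eqP => [->|//]; rewrite ?Yy ?andbF.
rewrite -mulnA; congr (_ * _); rewrite mulnC -[RHS]cardsT.
by rewrite -(card_orbit_stab to [group of setT] x) setTI.
Qed.

(** Multiple transitivity of the symmetric group, in a form that applies to enumerations of sets. *)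
Lemma perm_of_uniq (T : finType) (s t : seq T) :
  uniq s -> uniq t -> size s = size t -> exists u : {perm T}, map u s = t.
Proof.
move=> Us Ut eq_st.
have tr : [transitive^(size s) 'Sym_T, on setT | 'P].
  by apply: ntransitive_weak (Sym_trans T); rewrite -(card_uniqP Us) max_card.
have dt (r : seq T) (szr : size r == size s) :
    uniq r -> Tuple szr \in (size s).-dtuple([set: T]).
  by move=> Ur; rewrite inE /= Ur; apply/subsetP=> x; rewrite inE.
have sz_t : size t == size s by rewrite eq_st.
have [u _ /(congr1 val) /= eq_u] :=
  atransP2 tr (dt s (eqxx _) Us) (dt t sz_t Ut).
by exists u; rewrite eq_u; apply: eq_map.
Qed.

Definition pair_map (T T' : finType) (f : T -> T') (p : T * {set T}) :
  T' * {set T'} := (f p.1, f @: p.2).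

Definition pairs (T : finType) (k : nat) : {set T * {set T}} :=
  [set p : T * {set T} | (#|p.2| == k) && (p.1 \notin p.2)].

Fact perm_pair_is_action (T : finType) :
  is_action setT (fun (p : T * {set T}) (s : {perm T}) => pair_map s p).
Proof.
apply: is_total_action => [[a A]|[a A] s t]; rewrite /pair_map /=.
  by rewrite perm1 -[RHS]/(a, A); congr (_, _); rewrite -[RHS]imset_id;
     apply: eq_imset => i; rewrite perm1.
rewrite permM; congr (_, _); rewrite -imset_comp.
by apply: eq_imset => i; rewrite /= permM.
Qed.
Definition perm_pair_action (T : finType) := Action (@perm_pair_is_action T).

Lemma map_enum_imset (T T' : finType) (f : T -> T') (A : {set T}) (B : {set T'}) :
  map f (enum A) = enum B -> f @: A = B.
Proof.
move=> fAB; apply/setP=> y; rewrite -(mem_enum B) -fAB.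
by apply/imsetP/mapP => -[x Ax ->]; exists x; rewrite ?mem_enum // -?(mem_enum A).
Qed.

Lemma orbit_set (T : finType) (A : {set T}) :
  orbit ('P^* : {action {perm T} &-> {set T}}) setT A =
  [set B : {set T} | #|B| == #|A|].
Proof.
apply/setP=> B; rewrite inE; apply/orbitP/eqP => [[s _ <-]|cBA].
  by rewrite /= /setact card_imset //; apply: act_inj.
have [||| s sAB] := @perm_of_uniq T (enum A) (enum B); rewrite ?enum_uniq //.
  by rewrite -!cardE.
exists s; rewrite ?inE //; exact: map_enum_imset sAB.
Qed.

Lemma orbit_pair (T : finType) (k : nat) (p : T * {set T}) :
  p \in pairs T k -> orbit (@perm_pair_action T) setT p = pairs T k.
Proof.
case: p => a A; rewrite !inE /= => /andP[/eqP cA aA].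
apply/setP=> -[b B]; rewrite inE /=; apply/orbitP/andP => [[s _ [<- <-]]|[/eqP cB bB]].
  by rewrite (mem_imset _ _ perm_inj) card_imset ?cA //; apply: perm_inj.
(* With the -1 position at the head of each list, one permutation carries both components. *)
have [||| s [sab sAB]] := @perm_of_uniq T (a :: enum A) (b :: enum B).
- by rewrite /= mem_enum aA enum_uniq.
- by rewrite /= mem_enum bB enum_uniq.
- by rewrite /= -!cardE cA cB.
by exists s; rewrite ?inE //= /pair_map sab (map_enum_imset sAB).
Qed.

(** This shape, rather than [#|T| * 'C(#|T|.-1, k)], lets the binomial cancel against the number of
    [k.+1]-sets in the averaging. *)
Lemma card_pairs (T : finType) (k : nat) :
  #|pairs T k| = k.+1 * 'C(#|T|, k.+1).
Proof.
rewrite -mul_bin_diag -sum_nat_const -sum1_card.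
rewrite (partition_big fst predT) //=; apply: eq_bigr => a _.
rewrite -[#|T|.-1](cardsC1 a) -cards_draws -sum1_card.
rewrite (reindex_onto (pair a) snd) /= => [|[b A] /= /andP[_ /eqP->] //].
apply: eq_bigl => A; rewrite !inE /= !eqxx !andbT andbC.
by congr (_ && _); rewrite -[in RHS](setCK A) setCS sub1set inE.
Qed.

(** * The averaging bound *)

Lemma card_ord_interval (n a b : nat) :
  b <= n -> #|[set i : 'I_n | a <= i < b]| = b - a.
Proof.
move=> le_bn; rewrite -sum1dep_card.
rewrite -(big_mkord (fun i => a <= i < b) (fun=> 1)).
rewrite -[b - a]muln1 -sum_nat_const_nat.
rewrite (big_nat_widen _ _ _ _ _ le_bn) [RHS](big_nat_widenl _ 0) //=.
by apply: eq_bigl => i; rewrite andbC.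
Qed.

(** Here [r.+1] is the number of ones of a vector; the pairs in [G] have lost their one at the last
    coordinate. *)
Lemma leq_add_card_antishadow (n r : nat) (X : {set {set 'I_n}})
    (G : {set 'I_n * {set 'I_n}}) :
  r.+1 ^ 2 <= n ->
  {in X, forall A : {set 'I_n}, #|A| = r.+1} -> G \subset pairs 'I_n r ->
  {in G, forall p : 'I_n * {set 'I_n}, p.1 |: p.2 \in X} ->
  {in X & G, forall (A : {set 'I_n}) (p : 'I_n * {set 'I_n}),
     p.1 \in A -> ~~ [disjoint A & p.2]} ->
  #|X| + #|G| <= 'C(n, r.+1).
Proof.
move=> le_kn cX sG GX XG; pose k := r.+1.
pose ksets := [set A : {set 'I_n} | #|A| == k]; pose H := ksets :\: X.
have c_ksets : #|ksets| = 'C(n, k) by rewrite card_draws card_ord.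
have sX : X \subset ksets by apply/subsetP => A /cX cA; rewrite inE cA.
suff le_GH : #|G| <= #|H|.
  by rewrite -c_ksets -(cardsID X ksets) (setIidPr sX) leq_add2l.
(* [A0] and the [k] blocks [D j] of length [r], laid side by side, fill [k + k * r = k ^ 2]
   coordinates: hence the bound on [n]. *)
pose A0 : {set 'I_n} := [set i : 'I_n | 0 <= i < k].
pose D j : {set 'I_n} := [set i : 'I_n | k + j * r <= i < k + j.+1 * r].
have le_D j : j < k -> k + j.+1 * r <= n.
  move=> lt_jk; apply: leq_trans le_kn.
  by rewrite -mulnn mulnS leq_add2l leq_mul2r lt_jk orbT.
have le_k : k <= n by apply: leq_trans le_kn; rewrite -mulnn leq_pmulr.
have disjD j j' : j < j' -> [disjoint D j & D j'].
  move=> lt_jj'; rewrite -setI_eq0; apply/eqP/setP=> i; rewrite !inE.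
  apply/negP=> /andP[/andP[_ lt_i] /andP[le_i _]].
  have := leq_trans lt_i (leq_trans _ le_i).
  by rewrite ltnn leq_add2l leq_mul2r lt_jj' orbT => /(_ isT).
have disjA j : [disjoint A0 & D j].
  rewrite -setI_eq0; apply/eqP/setP=> i; rewrite !inE /=.
  apply/negP=> /andP[lt_i /andP[le_i _]].
  by have := leq_ltn_trans (leq_trans (leq_addr _ _) le_i) lt_i; rewrite ltnn.
have A0w (i : 'I_k) : widen_ord le_k i \in A0 by rewrite inE /=.
have pD (i j : 'I_k) : (widen_ord le_k i, D j) \in pairs 'I_n r.
  rewrite inE /= card_ord_interval ?le_D // subnDl -mulnBl subSnn mul1n eqxx /=.
  by rewrite (disjointFr (disjA j)).
pose to := perm_pair_action 'I_n.
pose tr (s : {perm 'I_n}) (i j : 'I_k) : bool :=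
  to (widen_ord le_k i, D j) s \in G.
have le_tr s : \sum_(i < k) \sum_(j < k) tr s i j <= k * (s @: A0 \in H).
  (* Were [s @: A0] in [X], it would contain the first component of the pair and so meet its set,
     although [A0] and [D j] are disjoint. *)
  have trE i j : tr s i j -> s @: A0 \in H.
    move=> sG_ij; rewrite inE [_ \in ksets]inE card_imset; last exact: perm_inj.
    rewrite card_ord_interval // subn0 eqxx andbT; apply/negP=> sAX.
    have /= := XG _ _ sAX sG_ij; rewrite (mem_imset _ _ perm_inj) A0w => /(_ isT).
    by rewrite (imset_disjoint perm_inj) disjA.
  have [sAH|nsAH] := boolP (_ \in H); last first.
    rewrite big1 // => i _; rewrite big1 // => j _.
    by apply/eqP; rewrite eqb0; apply: contra nsAH; apply: trE.
  rewrite muln1 -[X in _ <= X]card_ord -sum1_card; apply: leq_sum => i _.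
  (* Of two hits with the same [i], the first with its -1 position added lies in [X] and contains
     the -1 position of the second, so it would have to meet [s @: D j']. *)
  have tr_uniq (j j' : 'I_k) : j < j' -> tr s i j -> tr s i j' -> False.
    move=> lt_jj' /GX Gij Gij'; have /= := XG _ _ Gij Gij'.
    rewrite setU11 => /(_ isT)/negP[].
    rewrite disjoints_subset subUset sub1set inE (mem_imset _ _ perm_inj).
    rewrite (disjointFr (disjA _) (A0w i)) /= -disjoints_subset.
    by rewrite (imset_disjoint perm_inj) disjD.
  have [j trj|no_tr] := pickP (tr s i); last first.
    by rewrite big1 // => j _; rewrite no_tr.
  rewrite (bigD1 j) //= trj big1 // => j' ne_j; apply/eqP; rewrite eqb0.
  apply/negP=> trj'; case: (ltngtP j j') => [lt|lt|eq].
  - exact: tr_uniq lt trj trj'.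
  - exact: tr_uniq lt trj' trj.
  - by rewrite (val_inj eq) eqxx in ne_j.
have fact_gt0 : 0 < #|{: {perm 'I_n}}| by apply/card_gt0P; exists 1%g.
have countG (i j : 'I_k) :
  #|[set s | tr s i j]| * (k * 'C(n, k)) = #|G| * #|{: {perm 'I_n}}|.
  have := count_orbit (to := to) (x := (widen_ord le_k i, D j)) (Y := G).
  by rewrite (orbit_pair (pD i j)) card_pairs card_ord; apply.
have countH :
  #|[set s : {perm 'I_n} | s @: A0 \in H]| * 'C(n, k) = #|H| * #|{: {perm 'I_n}}|.
  pose toP := ('P^* : {action {perm 'I_n} &-> {set 'I_n}})%act.
  have := count_orbit (to := toP) (x := A0) (Y := H).
  rewrite orbit_set card_ord_interval // subn0 c_ksets => <-; last exact: subsetDl.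
  by [].
have : \sum_s \sum_(i < k) \sum_(j < k) tr s i j
     <= k * #|[set s : {perm 'I_n} | s @: A0 \in H]|.
  rewrite -sum1dep_card big_distrr /= [leqRHS]big_mkcond; apply: leq_sum => s _.
  by apply: leq_trans (le_tr s) _; case: ifP => _; rewrite ?muln0.
rewrite exchange_big /=; under eq_bigr do rewrite exchange_big /=.
(* The factor is the size of the orbit of pairs. After scaling, each of the [k ^ 2] counts on the
   left is [#|G|] times the number of permutations, and the right side is [k ^ 2 * #|H|] times that
   number. *)
rewrite -(leq_pmul2r (m := k * 'C(n, k))) ?muln_gt0 ?bin_gt0 ?le_k //.
rewrite big_distrl /=; under eq_bigr => i _.
  rewrite big_distrl /=; under eq_bigr => j _.
    rewrite -big_mkcond sum1dep_card countG.
    over.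
  rewrite sum_nat_const card_ord. over.
rewrite sum_nat_const card_ord.
rewrite [X in _ <= X](_ : _ = k * (k * (#|H| * #|{: {perm 'I_n}}|))); last first.
  by rewrite -countH !mulnA; congr (_ * _); rewrite mulnAC.
by rewrite !leq_pmul2l // leq_pmul2r.
Qed.

(** * Families of codes without opposite pairs *)

Definition opposite (T : finType) (p q : T * {set T}) : bool :=
  [&& p.1 \in q.2, q.1 \in p.2 & [disjoint p.2 & q.2]].

Definition nonopposite (T : finType) (k : nat) (F : {set T * {set T}}) : bool :=
  (F \subset pairs T k) && [forall p in F, forall q in F, ~~ opposite p q].

Definition max_nonopposite (T : finType) (k : nat) : nat :=
  \max_(F : {set T * {set T}} | nonopposite k F) #|F|.

Lemma nonoppositeP (T : finType) (k : nat) (F : {set T * {set T}}) :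
  reflect ({subset F <= pairs T k} /\ {in F &, forall p q, ~~ opposite p q})
    (nonopposite k F).
Proof.
apply: (iffP andP) => -[/subsetP sF oF]; split=> //.
  by move=> p q Fp; apply/implyP; move: q; apply/forallP; exact: (forall_inP oF).
  by apply/forall_inP=> p Fp; apply/forall_inP=> q Fq; apply: oF.
Qed.

Lemma card_nonopposite (T : finType) (k : nat) (F : {set T * {set T}}) :
  nonopposite k F -> #|F| <= max_nonopposite T k.
Proof. exact: (@leq_bigmax_cond _ _ (fun F : {set T * {set T}} => #|F|)). Qed.

Lemma max_nonopposite_witness (T : finType) (k : nat) :
  exists2 F : {set T * {set T}}, nonopposite k F & #|F| = max_nonopposite T k.
Proof.
have : 0 < #|[pred F : {set T * {set T}} | nonopposite k F]|.
  apply/card_gt0P; exists set0; rewrite inE; apply/nonoppositeP.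
  by split=> [p|p q]; rewrite inE.
by case/(eq_bigmax_cond (fun F : {set T * {set T}} => #|F|)) => F oF eF; exists F.
Qed.

Section PairMap.
Variables (T T' : finType) (f : T -> T').
Hypothesis inj_f : injective f.

Lemma pair_map_inj : injective (pair_map f).
Proof. by move=> [a A] [b B] [/inj_f -> /(imset_inj inj_f) ->]. Qed.

Lemma pair_map_pairs (k : nat) (p : T * {set T}) :
  (pair_map f p \in pairs T' k) = (p \in pairs T k).
Proof. by rewrite !inE /= card_imset // mem_imset. Qed.

Lemma opposite_pair_map (p q : T * {set T}) :
  opposite (pair_map f p) (pair_map f q) = opposite p q.
Proof. by rewrite /opposite /= !mem_imset // imset_disjoint. Qed.

End PairMap.

(** * Shifting *)

Section Shift.
Variables (T : finType) (k : nat) (x y : T).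
Hypothesis neq_xy : x != y.
Implicit Types (p q : T * {set T}) (F : {set T * {set T}}).

Let swap := pair_map (tperm x y).

(* The vector coded by [p] has a smaller coordinate at [x] than at [y]. *)
Definition below p : bool := (p.1 == x) || (y \in p.2) && (x \notin p.2).

Definition shift F p := if below p && (swap p \notin F) then swap p else p.

Let swapK : involutive swap.
Proof.
move=> [a A]; rewrite /swap /pair_map /= tpermK -imset_comp; congr (_, _).
by rewrite -[RHS]imset_id; apply: eq_imset => i /=; rewrite tpermK.
Qed.

Let mem_swap p z : (z \in (swap p).2) = (tperm x y z \in p.2).
Proof. by rewrite -[z in LHS](tpermK x y) mem_imset //; apply: perm_inj. Qed.

(* Rearrangement inequality: the scalar product with [w] does not drop when
   [v] is swapped, unless [w] is below too. *)
Lemma opposite_swap v w :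
  v \in pairs T k -> w \in pairs T k -> below v -> ~~ below w ->
  opposite (swap v) w -> opposite v w.
Proof.
case: v w => a A [c C]; rewrite !inE /below /opposite /=.
move=> /andP[_ aA] /andP[_ cC] bv; rewrite negb_or negb_and negbK => /andP[ncx yx].
case/and3P=> aC; rewrite (mem_swap (a, A)) /= => cA dAC.
have d z : z \in C -> tperm x y z \notin A.
  by move=> Cz; rewrite -(mem_swap (a, A)); apply: contraL Cz => /(disjointFr dAC) ->.
have CyCx : y \in C -> x \in C by move=> Cy; rewrite Cy in yx.
(* If the -1 of [v] is not at [x], then [y] is in [A] and [x] is not; this keeps both [x] and [y]
   out of [C], where the swap is then invisible. *)
have [eq_ax|ne_ax] := eqVneq a x; last first.
  move: bv; rewrite (negPf ne_ax) /= => /andP[Ay xA].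
  have xC : x \notin C by apply/negP=> /d; rewrite tpermL Ay.
  have yC : y \notin C := contra CyCx xC.
  have ne_ay : a != y by apply: contraNneq aA => ->.
  rewrite tpermD 1?eq_sym // in aC; rewrite aC.
  have ne_cy : c != y by apply: contraTneq cA => ->; rewrite tpermR.
  move: cA; rewrite tpermD 1?eq_sym // => -> /=.
  rewrite disjoint_sym disjoints_subset; apply/subsetP => z Cz; rewrite inE.
  have := d z Cz; rewrite tpermD //.
    by apply: contraNneq xC => ->.
  by apply: contraNneq yC => ->.
(* Now the swap brings the -1 to [y], so [y] is in [C], and [x] too since [w] is not below. *)
rewrite {a bv}eq_ax tpermL in aA aC *; have Cx := CyCx aC.
rewrite Cx; have yA : y \notin A by have := d x Cx; rewrite tpermL.
have ne_cy : c != y by apply: contraNneq cC => ->.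
move: cA; rewrite tpermD 1?eq_sym // => -> /=.
rewrite disjoint_sym disjoints_subset; apply/subsetP => z Cz; rewrite inE.
have [-> //|ne_zx] := eqVneq z x; have [-> //|ne_zy] := eqVneq z y.
by have := d z Cz; rewrite tpermD // eq_sym.
Qed.

(** A moved element leaves [F] and an unmoved one stays in it, so only two moved elements could
    collide. *)
Lemma shift_inj F : {in F &, injective (shift F)}.
Proof.
move=> p q Fp Fq; rewrite /shift.
case: ifP => [/andP[_ nFp]|_]; case: ifP => [/andP[_ nFq]|_] //.
- exact: (can_inj swapK).
- by move=> eq; rewrite eq Fq in nFp.
- by move=> eq; rewrite -eq Fp in nFq.
Qed.

Lemma shift_nonopposite F : nonopposite k F -> nonopposite k (shift F @: F).
Proof.
move=> /nonoppositeP[sF oF]; apply/nonoppositeP; split.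
  move=> _ /imsetP[p Fp ->]; rewrite /shift; case: ifP => _; last exact: sF.
  by rewrite pair_map_pairs ?sF //; apply: perm_inj.
(* One moved and one unmoved element: either [swap q] is in [F] and the swap is transferred to [q],
   or [q] is not below and [opposite_swap] applies. *)
have mixed p q : p \in F -> q \in F -> below p -> ~~ (below q && (swap q \notin F)) ->
    ~~ opposite (swap p) q.
  move=> Fp Fq bp; rewrite negb_and negbK.
  have [bq /= Fsq|nbq _] := boolP (below q).
    by rewrite -[q]swapK (opposite_pair_map (@perm_inj _ _)) oF.
  by apply: contra (oF p q Fp Fq); apply: opposite_swap; rewrite ?sF.
have oppC p q : opposite p q = opposite q p.
  by rewrite /opposite andbCA disjoint_sym.
move=> _ _ /imsetP[p Fp ->] /imsetP[q Fq ->]; rewrite /shift.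
have [/andP[bp nFp]|np] := boolP (_ && _); have [/andP[bq nFq]|nq] := boolP (_ && _).
- by rewrite (opposite_pair_map (@perm_inj _ _)) oF.
- exact: mixed.
- by rewrite oppC; apply: mixed.
- exact: oF.
Qed.

(* One minus the coordinate at [y] of the vector coded by [p]. *)
Definition weight p : nat := if p.1 == y then 2 else (y \notin p.2).

Lemma weight_swap p : p \in pairs T k -> below p -> weight p < weight (swap p).
Proof.
case: p => a A; rewrite inE /below /weight mem_swap /= => /andP[_ aA].
rewrite tpermR; have [-> _|ne_ax /= /andP[Ay xA]] := eqVneq a x.
  by rewrite tpermL eqxx (negPf neq_xy); case: (_ \in _).
have ne_ay : a != y by apply: contraNneq aA => ->.
have -> : tperm x y a = a by rewrite tpermD // eq_sym.
by rewrite (negPf ne_ay) Ay xA.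
Qed.

Lemma leq_weight_shift F p : p \in pairs T k ->
  weight p <= weight (shift F p) ?= iff ~~ (below p && (swap p \notin F)).
Proof.
move=> Pp; rewrite /shift; case: ifP => [/andP[bp _]|_] /=; last exact/leqif_refl.
by have lt := weight_swap Pp bp; split; [apply: ltnW | apply: ltn_eqF].
Qed.

(** The total weight is a potential for the shifts; its equality case says that [F] is already
    stable. *)
Lemma sum_weight_shift F : nonopposite k F ->
  \sum_(p in F) weight p <= \sum_(p in shift F @: F) weight p
    ?= iff [forall (p | p \in F), ~~ (below p && (swap p \notin F))].
Proof.
move=> /nonoppositeP[sF _]; rewrite big_imset; last exact: shift_inj.
by apply: leqif_sum => p Fp; apply: leq_weight_shift; apply: sF.
Qed.

End Shift.

(** Since [weight] depends on [y] only, a single extremal family of maximal weight is stable for all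
    [x] at once. *)
Lemma shifted_extremal (T : finType) (k : nat) (y : T) :
  exists2 F : {set T * {set T}}, nonopposite k F /\ #|F| = max_nonopposite T k
    & forall x p, x != y -> p \in F -> below x y p -> pair_map (tperm x y) p \in F.
Proof.
have [F0 oF0 cF0] := max_nonopposite_witness T k.
pose P (F : {set T * {set T}}) := nonopposite k F && (#|F| == max_nonopposite T k).
have PF0 : P F0 by rewrite /P oF0 cF0 eqxx.
case: (arg_maxnP (fun F : {set T * {set T}} => \sum_(p in F) weight y p) PF0).
move=> F /andP[oF /eqP cF] maxF; exists F => // x p ne_xy Fp bp.
have [le_w] := sum_weight_shift ne_xy oF.
have PF' : P (shift x y F @: F).
  by rewrite /P shift_nonopposite // card_in_imset ?cF ?eqxx //; apply: shift_inj.
rewrite eqn_leq le_w [_ <= _]maxF // => /esym/forall_inP/(_ p Fp).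
by rewrite bp negbK.
Qed.

(** * The two inequalities of the recursion *)

Lemma max_nonopposite_recl (k n : nat) :
  max_nonopposite 'I_n k + 'C(n, k) <= max_nonopposite 'I_n.+1 k.
Proof.
have [F oF <-] := max_nonopposite_witness 'I_n k.
move: oF => /nonoppositeP[sF oF]; pose f : 'I_n -> 'I_n.+1 := lift ord_max.
have inj_f : injective f := @lift_inj _ _.
have fN i : f i != ord_max by rewrite eq_sym neq_lift.
have inj_g : injective (fun A : {set 'I_n} => (@ord_max n, f @: A)).
  by move=> A B [/(imset_inj inj_f)].
have nf (A : {set 'I_n}) : ord_max \notin f @: A.
  by apply/imsetP=> -[i _ /esym/eqP]; rewrite (negPf (fN i)).
pose ksets := [set A : {set 'I_n} | #|A| == k].
pose G := [set (@ord_max n, f @: A) | A : {set 'I_n} in ksets].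
rewrite -(card_imset (mem F) (pair_map_inj inj_f)).
have <- : #|G| = 'C(n, k) by rewrite card_imset // card_draws card_ord.
have disjFG : [disjoint pair_map f @: F & G].
  rewrite disjoints_subset; apply/subsetP=> _ /imsetP[p _ ->]; rewrite inE.
  by apply/imsetP=> -[A _ /(congr1 fst)/eqP /=]; rewrite (negPf (fN _)).
rewrite -cardsUI (eqP (_ : _ :&: _ == set0)) ?setI_eq0 // cards0 addn0.
apply: card_nonopposite; apply/nonoppositeP; split.
  move=> z /setUP[] /imsetP[]; first by move=> p Fp ->; rewrite pair_map_pairs ?sF.
  by move=> A; rewrite inE => cA ->; rewrite inE /= card_imset // cA nf.
(* No vector here has a one at [ord_max], so those with their -1 there are opposite to none. *)
move=> z w /setUP[] /imsetP[p Fp ->] /setUP[] /imsetP[q Fq ->].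
- by rewrite opposite_pair_map ?oF.
- by rewrite /opposite /= (negPf (nf _)) /= andbF.
- by rewrite /opposite /= (negPf (nf _)).
- by rewrite /opposite /= (negPf (nf _)).
Qed.

Lemma max_nonopposite_recr (k n : nat) : 0 < k -> k ^ 2 <= n ->
  max_nonopposite 'I_n.+1 k <= max_nonopposite 'I_n k + 'C(n, k).
Proof.
case: k => [|r] // _ le_n; pose N := @ord_max n.
have [F [/nonoppositeP[sF oF] <-] shF] := shifted_extremal r.+1 N.
pose f : 'I_n -> 'I_n.+1 := lift N; have inj_f : injective f := @lift_inj _ _.
have fN i : f i != N by rewrite eq_sym neq_lift.
have nf (A : {set 'I_n}) : N \notin f @: A.
  by apply/imsetP=> -[i _ /esym/eqP]; rewrite (negPf (fN i)).
have preimK (A : {set 'I_n.+1}) : N \notin A -> f @: (f @^-1: A) = A.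
  move=> NA; apply/setP=> z; apply/imsetP/idP => [[i + ->]|Az]; first by rewrite inE.
  case: (unliftP N z) Az => [i ->|->] Az; last by rewrite Az in NA.
  by exists i; rewrite ?inE.
pose g1 (A : {set 'I_n}) := (N, f @: A).
pose g2 (p : 'I_n * {set 'I_n}) := (f p.1, N |: f @: p.2).
pose F0 := pair_map f @^-1: F; pose X := g1 @^-1: F; pose G := g2 @^-1: F.
(* The three pieces correspond to the values 0, -1 and 1 of the coordinate at [N]. *)
have coverF : F \subset (pair_map f @: F0) :|: (g1 @: X :|: g2 @: G).
  apply/subsetP=> -[a A] Fp; have := sF _ Fp; rewrite inE /= => /andP[_ aA].
  rewrite !inE; case: (unliftP N a) (Fp) aA => [i ->|->] {Fp}Fp aA; last first.
    apply/orP; right; apply/orP; left; apply/imsetP.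
    by exists (f @^-1: A); rewrite ?inE /g1 preimK.
  have [NA|NA] := boolP (N \in A); last first.
    apply/orP; left; apply/imsetP; exists (i, f @^-1: A).
      by rewrite inE /pair_map /= preimK.
    by rewrite /pair_map /= preimK.
  have eqA : N |: f @: (f @^-1: (A :\ N)) = A by rewrite preimK ?setD11 ?setD1K.
  apply/orP; right; apply/orP; right; apply/imsetP.
  by exists (i, f @^-1: (A :\ N)); rewrite ?inE /g2 /= eqA.
apply: leq_trans (subset_leq_card coverF) _.
apply: leq_trans (leq_card_setU _ _) _; apply: leq_add.
  apply: leq_trans (leq_imset_card _ _) _; apply: card_nonopposite.
  apply/nonoppositeP; split=> [p|p q]; rewrite !inE => Fp.
    by have := sF _ Fp; rewrite pair_map_pairs // inE.
  by move=> Fq; rewrite -(opposite_pair_map inj_f) oF.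
apply: leq_trans (leq_card_setU _ _) _.
apply: leq_trans (leq_add (leq_imset_card _ _) (leq_imset_card _ _)) _.
have X_mem A : (A \in X) = ((N, f @: A) \in F) by rewrite inE.
have G_mem p : (p \in G) = ((f p.1, N |: f @: p.2) \in F) by rewrite inE.
apply: leq_add_card_antishadow => //.
- by move=> A; rewrite X_mem => /sF; rewrite inE /= card_imset // => /andP[/eqP].
- apply/subsetP=> p; rewrite G_mem => /sF; rewrite !inE /= cardsU1 nf card_imset //.
  by rewrite negb_or mem_imset // add1n eqSS => /andP[-> /andP[_ ->]].
(* Shifting with [x := f b] exchanges the -1 at [f b] with the one at [N]. *)
- move=> [b B]; rewrite G_mem X_mem /= => FbB.
  have := sF _ FbB; rewrite !inE /= negb_or mem_imset // => /and3P[_ _ bB].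
  have := shF _ _ (fN b) FbB; rewrite /below /= eqxx => /(_ isT).
  rewrite /pair_map /= tpermL; congr ((_, _) \in F).
  rewrite !imsetU1 tpermR; congr (_ |: _); rewrite -imset_comp.
  apply: eq_in_imset => i Bi /=; rewrite tpermD 1?eq_sym ?fN //.
  by rewrite (inj_eq inj_f); apply: contraNneq bB => <-.
- move=> A [b B]; rewrite X_mem G_mem /= => FA FbB Ab.
  have := oF _ _ FbB FA; rewrite /opposite /= mem_imset // Ab setU11 /=.
  apply: contra => dAB; rewrite disjoints_subset subUset sub1set inE nf /=.
  by rewrite -disjoints_subset imset_disjoint // disjoint_sym.
Qed.

Import Order.TTheory GRing.Theory Num.Theory.
Local Open Scope ring_scope.

(** * From real vectors to codes *)

Section Coding.
Variables (R : realType) (n k : nat).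
Implicit Types (p q : 'I_n * {set 'I_n}) (v w : V1 R n k).

(** A difference of indicators makes [dotv] expand bilinearly. *)
Definition vec_of_pair p : 'rV[R]_n :=
  \row_i ((i \in p.2)%:R - (i == p.1)%:R).

Lemma dotv_vec_of_pair p q :
  dotv (vec_of_pair p) (vec_of_pair q) =
  #|p.2 :&: q.2|%:R - (p.1 \in q.2)%:R - (q.1 \in p.2)%:R + (p.1 == q.1)%:R.
Proof.
have pick (c : 'I_n) (P : pred 'I_n) : \sum_i (i == c)%:R * (P i)%:R = (P c)%:R :> R.
  by rewrite (bigD1 c) //= eqxx mul1r big1 ?addr0 // => i /negPf ->; rewrite mul0r.
rewrite /dotv; under eq_bigr => i _.
  rewrite !mxE mulrBl !mulrBr [(i \in p.2)%:R * (i == _)%:R]mulrC.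
  over.
rewrite !sumrB pick pick pick -sum1_card natr_sum.
have -> : \sum_i (i \in p.2)%:R * (i \in q.2)%:R
        = \sum_(i in p.2 :&: q.2) 1%:R :> R.
  rewrite [RHS]big_mkcond; apply: eq_bigr => i _; rewrite inE.
  by case: (_ \in _); case: (_ \in _); rewrite ?mulr1 ?mulr0 ?mul0r.
by ring.
Qed.

(** The value -2 requires both negative terms of [dotv_vec_of_pair] and no positive one; when the -1
    positions agree, the hypothesis removes a negative term. *)
Lemma dotv_opposite p q : p.1 \notin p.2 ->
  (dotv (vec_of_pair p) (vec_of_pair q) > -2) = ~~ opposite p q.
Proof.
move=> pNp; rewrite dotv_vec_of_pair /opposite -setI_eq0 -cards_eq0.
have [eq|_] := eqVneq p.1 q.1.
  rewrite -eq (negPf pNp) andbF /= subr0; apply/idP.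
  have := ler0n R #|p.2 :&: q.2|; have := ler0n R (p.1 \in q.2).
  by case: (_ \in _) => /=; lra.
case: #|_| => [|m]; last first.
  rewrite !andbF -natr1; apply/idP; have := ler0n R m.
  by case: (_ \in _); case: (_ \in _) => /=; lra.
case: (_ \in _); case: (_ \in _) => /=; [apply/negbTE; rewrite -leNgt|..];
  by try apply/idP; lra.
Qed.

Let oneN1 : (1 == -1 :> R) = false.
Proof. by apply/negbTE/eqP; lra. Qed.

Lemma vec_of_pairE p i : p.1 \notin p.2 ->
  vec_of_pair p 0 i = if i \in p.2 then 1 else if i == p.1 then -1 else 0.
Proof.
move=> pNp; rewrite mxE; have [->|_] := eqVneq i p.1.
  by rewrite (negPf pNp) sub0r.
by case: (i \in p.2); rewrite subr0.
Qed.

Lemma ones_vec_of_pair p : p.1 \notin p.2 ->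
  [set i | vec_of_pair p 0 i == 1] = p.2.
Proof.
move=> pNp; apply/setP=> i; rewrite inE vec_of_pairE //.
case: (i \in p.2); rewrite ?eqxx //.
by case: (i == p.1); rewrite eq_sym ?oneN1 ?oner_eq0.
Qed.

Lemma minus_ones_vec_of_pair p : p.1 \notin p.2 ->
  [set i | vec_of_pair p 0 i == -1] = [set p.1].
Proof.
move=> pNp; apply/setP=> i; rewrite !inE vec_of_pairE //.
have [->|_] := eqVneq i p.1; first by rewrite (negPf pNp) eqxx.
by case: (i \in p.2); rewrite ?oneN1 // eq_sym oppr_eq0 oner_eq0.
Qed.

Lemma vec_of_pair_inV1 p : p \in pairs 'I_n k -> inV1 k (vec_of_pair p).
Proof.
rewrite inE => /andP[cp pNp]; apply/and3P; split.
- apply/forallP=> i; rewrite vec_of_pairE // !inE.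
  by do 2?[case: ifP]; rewrite !eqxx ?orbT.
- by rewrite ones_vec_of_pair.
- by rewrite minus_ones_vec_of_pair // cards1.
Qed.

(** Boolean equality allows [sig2W] to extract a code. *)
Lemma vec_of_pairP v : exists2 p, p \in pairs 'I_n k & vec v == vec_of_pair p.
Proof.
have /and3P[/forallP v01 cA /cards1P[a /setP eq_a]] := vecP v.
have v_a i : (i == a) = (vec v 0 i == -1) by have := eq_a i; rewrite !inE.
exists (a, [set i | vec v 0 i == 1]).
  have /eqP va : vec v 0 a == -1 by rewrite -v_a.
  by rewrite !inE /= cA va eq_sym oneN1.
apply/eqP/rowP=> i; rewrite mxE inE /= v_a; have := v01 i; rewrite !inE.
case/or3P=> /eqP ->; rewrite ?eqxx.
- by rewrite ![0 == _]eq_sym oppr_eq0 oner_eq0 subr0.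
- by rewrite oneN1 subr0.
- by rewrite eq_sym oneN1 sub0r.
Qed.

Lemma vec_of_pair_inj : {in pairs 'I_n k &, injective vec_of_pair}.
Proof.
move=> p q; rewrite !inE => /andP[_ pNp] /andP[_ qNq] eq_pq.
have := ones_vec_of_pair pNp; have := minus_ones_vec_of_pair pNp.
rewrite eq_pq ones_vec_of_pair ?minus_ones_vec_of_pair // => /set1_inj + eq2.
by case: p q eq2 {pNp qNq eq_pq} => a A [b B] /= -> ->.
Qed.

Lemma m1E : m1 R n k = max_nonopposite 'I_n k.
Proof.
pose code v := s2val (sig2W (vec_of_pairP v)).
have code_pairs v : code v \in pairs 'I_n k by rewrite /code; case: sig2W.
have codeK v : vec v = vec_of_pair (code v).
  by apply/eqP; rewrite /code; case: sig2W.
have code_inj : injective code.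
  by move=> v w eq_c; apply: val_inj; rewrite /= !codeK eq_c.
have dot_code v w : (dotv (vec v) (vec w) > -2) = ~~ opposite (code v) (code w).
  by rewrite !codeK dotv_opposite //; have := code_pairs v; rewrite inE => /andP[].
apply/eqP; rewrite eqn_leq; apply/andP; split.
  apply/bigmax_leqP=> F iF; rewrite -(card_imset (mem F) code_inj).
  apply: card_nonopposite; apply/nonoppositeP; split=> [_ /imsetP[v _ ->] // |].
  move=> _ _ /imsetP[v Fv ->] /imsetP[w Fw ->]; rewrite -dot_code.
  exact: (forall_inP (forall_inP iF v Fv)).
have [G /nonoppositeP[sG oG] <-] := max_nonopposite_witness 'I_n k.
have -> : G = code @: (code @^-1: G).
  apply/setP=> p; apply/idP/imsetP=> [Gp|[v + ->]]; last by rewrite inE.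
  have eq_p : code (MkV1 (vec_of_pair_inV1 (sG p Gp))) = p.
    by apply: vec_of_pair_inj (code_pairs _) (sG p Gp) _; rewrite -(codeK (MkV1 _)).
  by exists (MkV1 (vec_of_pair_inV1 (sG p Gp))); rewrite ?inE eq_p.
rewrite card_imset // /m1.
apply: (@leq_bigmax_cond _ _ (fun F : {set V1 R n k} => #|F|)).
apply/forall_inP=> v; rewrite inE => Gv; apply/forall_inP=> w; rewrite inE => Gw.
by rewrite dot_code oG.
Qed.

End Coding.

Theorem theorem3 (R : realType) (k n : nat) (hk : (2 <= k)%N) (hn : (k ^ 2 <= n)%N) :
  m1 R n.+1 k = (m1 R n k + 'C(n, k))%N.
Proof.
apply/eqP; rewrite !m1E eqn_leq max_nonopposite_recl.
by rewrite max_nonopposite_recr // ltnW.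
Qed.
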